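(* Let $p$ be a prime with $p\equiv 5\pmod 6$. Then $$\sum_{k=0}^{p-1}\frac{\binom{2k}{k}^2\binom{3k}{k}}{(-192)^k}\equiv 0\pmod{p^2}.$$
   Context: Congruences modulo $p^2$ are taken in the ring $\mathbb{Z}_p$ of rational numbers whose denominator is coprime to $p$: for $u,v$ in this ring, $u\equiv v\pmod{p^2}$ means $(u-v)/p^2$ lies in this ring. *)

(* Defs.v *)
From mathcomp Require Import all_boot all_order all_algebra.

Set Implicit Arguments.
Unset Strict Implicit.
Unset Printing Implicit Defensive.

Import GRing.Theory.
Local Open Scope ring_scope.

(* denq u is the denominator of u in lowest terms, so this is the localization
   of the integers at p when p is prime. *)
Definition p_integral (p : nat) (u : rat) : bool := coprime p `|denq u|%N.

(* A congruence in that ring presupposes that both sides belong to it. *)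
Definition eqmod_p_integral (p : nat) (m : rat) (u v : rat) : Prop :=
  [/\ p_integral p u, p_integral p v & p_integral p ((u - v) / m)].

(* Main.v *)
Require Import Defs.
From mathcomp Require Import all_boot all_order all_algebra.
From mathcomp Require Import finfield ring zify.
From HB Require Import structures.

Set Implicit Arguments.
Unset Strict Implicit.
Unset Printing Implicit Defensive.

Import GRing.Theory Num.Theory.
Local Open Scope ring_scope.

(** Write a_k = 'C(2k, k) 'C(3k, k) = (3k)! / k!^3 and
    c_k = 'C(2k, k)^2 'C(3k, k). The proof expresses the sum modulo p^2 as the
    square of a sum that vanishes modulo p.

    Clausen's formula says that the power series sum a_k x^k has square
    sum c_k (x (1 - 27x))^k. It is proved here for truncations
    ([clausen_trunc]): both sides satisfy one third-order differential equation,
    which determines a power series from its constant term. Truncating both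
    sides at k < p, the coefficients agree below degree p, and from degree p on
    they are divisible by p^2 on each side ([clausen_mod_p2]). Since
    x = -1/216 gives x (1 - 27x) = -1/192, the sum of the theorem is congruent
    modulo p^2 to the square of T = sum_(k < p) a_k (-1/216)^k.

    It remains to see that p divides T ([trinom_sum0]). Up to sign, T modulo p is
    the coefficient of (xyz)^(p-1) in (x^3 + y^3 + z^3 + 6xyz)^(p-1), the Hasse
    invariant of that cubic curve, and this coefficient is also minus the sum of
    that power over all points of the three-dimensional space over the prime
    field ([hesse_expand]). The cubic is a member of the Hesse pencil isomorphic
    to the Fermat cubic, which is supersingular for p = 2 mod 3. Concretely, in
    suitable coordinates the form is u^3 + G with G independent of u, and since
    cubing permutes the prime field the sum vanishes ([hesse_sum0]). *)

(** * Recurrences for the coefficients *)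

(** The trinomial coefficient (3k)! / k!^3. *)
Definition trinom (k : nat) : nat := ('C(2 * k, k) * 'C(3 * k, k))%N.
Definition clausen_coef (k : nat) : nat := ('C(2 * k, k) ^ 2 * 'C(3 * k, k))%N.

Lemma central_bin_fact k : ('C(2 * k, k) * k`! ^ 2 = (2 * k)`!)%N.
Proof.
have := @bin_fact (2 * k) k; rewrite (_ : (2 * k - k)%N = k) //; lia.
Qed.

Lemma trinom_fact k : (trinom k * k`! ^ 3 = (3 * k)`!)%N.
Proof.
have /(_ _)<- := @bin_fact (3 * k) k; last by lia.
rewrite (_ : (3 * k - k = 2 * k)%N); last by lia.
by rewrite -central_bin_fact /trinom; ring.
Qed.

(** This ratio is that of the hypergeometric series 2F1(1/3, 2/3; 1; 27x). *)
Lemma trinom_rec k : (k.+1 ^ 2 * trinom k.+1 = 3 * (3 * k + 1) * (3 * k + 2) * trinom k)%N.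
Proof.
have k3 : (0 < k`! ^ 3)%N by rewrite expn_gt0 fact_gt0.
apply/eqP; rewrite -(eqn_pmul2r k3) -(eqn_pmul2r (ltn0Sn k)); apply/eqP.
transitivity (trinom k.+1 * k.+1`! ^ 3)%N; first by rewrite factS; ring.
rewrite trinom_fact mulnS addnC !addnS addn0 !factS -trinom_fact; ring.
Qed.

Lemma central_bin_rec k : (k.+1 * 'C(2 * k.+1, k.+1) = 2 * (2 * k + 1) * 'C(2 * k, k))%N.
Proof.
have k3 : (0 < k`! ^ 2)%N by rewrite expn_gt0 fact_gt0.
apply/eqP; rewrite -(eqn_pmul2r k3) -(eqn_pmul2r (ltn0Sn k)); apply/eqP.
transitivity ('C(2 * k.+1, k.+1) * k.+1`! ^ 2)%N; first by rewrite factS; ring.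
rewrite central_bin_fact mulnS addnC !addnS addn0 !factS -central_bin_fact; ring.
Qed.

(** This ratio is that of 3F2(1/2, 1/3, 2/3; 1, 1; 108w). *)
Lemma clausen_coef_rec k :
  (k.+1 ^ 3 * clausen_coef k.+1 = 6 * (2 * k + 1) * (3 * k + 1) * (3 * k + 2) * clausen_coef k)%N.
Proof.
have clausen_coefE n : clausen_coef n = ('C(2 * n, n) * trinom n)%N by rewrite /clausen_coef /trinom; ring.
rewrite !clausen_coefE expnSr.
transitivity ((k.+1 * 'C(2 * k.+1, k.+1)) * (k.+1 ^ 2 * trinom k.+1))%N; first by ring.
rewrite trinom_rec central_bin_rec; ring.
Qed.

(** * Clausen's formula for truncated series *)

(** The Euler operator turns the recurrences above into differential
    equations. It is locked so that the Leibniz rule does not match a bare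
    [theta q], whose body is a product. *)
HB.lock Definition theta (R : nzRingType) (q : {poly R}) : {poly R} := 'X * q^`().

Lemma coef_theta (R : nzRingType) (q : {poly R}) m : (theta q)`_m = q`_m *+ m.
Proof. by rewrite theta.unlock coefXM coef_deriv; case: m. Qed.

Section Clausen.
Local Notation th := (@theta rat).
Implicit Types q : {poly rat}.

Lemma thetaD q1 q2 : th (q1 + q2) = th q1 + th q2.
Proof. by rewrite theta.unlock derivD mulrDr. Qed.
Lemma thetaN q : th (- q) = - th q.
Proof. by rewrite theta.unlock derivN mulrN. Qed.
Lemma thetaM q1 q2 : th (q1 * q2) = th q1 * q2 + q1 * th q2.
Proof. by rewrite theta.unlock derivM; ring. Qed.

Definition one_sub_27X : {poly rat} := 1 - 27%:R * 'X.
Definition one_sub_54X : {poly rat} := 1 - 54%:R * 'X.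
Local Notation d := one_sub_27X.
Local Notation h := one_sub_54X.
Definition clausen_arg : {poly rat} := 'X * d.

(** This is the symmetric square of the second-order operator that kills
    2F1(1/3, 2/3; 1; 27x), with denominators cleared: it kills the products
    of any two solutions. *)
Definition clausen_op q : {poly rat} :=
  d ^+ 2 * th (th (th q)) - 81%:R * 'X * d * th (th q)
  - (51%:R * 'X - 2106%:R * 'X ^+ 2) * th q - (12%:R * 'X - 648%:R * 'X ^+ 2) * q.

Lemma theta_natX n : th (n%:R * 'X) = n%:R * 'X.
Proof. by rewrite theta.unlock derivM -polyC_natr derivC derivX; ring. Qed.
Lemma theta_d : th d = - (27%:R * 'X).
Proof. by rewrite theta.unlock /d derivB derivM -polyC_natr !derivC derivX; ring. Qed.
Lemma theta_h : th h = - (54%:R * 'X).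
Proof. by rewrite theta.unlock /h derivB derivM -polyC_natr !derivC derivX; ring. Qed.

Definition trinom_poly N : {poly rat} := \poly_(k < N.+1) (trinom k)%:R.
Definition clausen_poly N : {poly rat} := \poly_(k < N.+1) (clausen_coef k)%:R.


(** Truncating the hypergeometric series leaves a single monomial of defect,
    because the recurrence fails only at the cut. *)
Lemma trinom_poly_ode N : exists e : rat,
  th (th (trinom_poly N)) =
    3%:R * ('X * (9%:R * th (th (trinom_poly N)) + 9%:R * th (trinom_poly N) + 2%:R * trinom_poly N))
    - e%:P * 'X^(N.+1).
Proof.
exists ((N.+1 ^ 2 * trinom N.+1)%N%:R); apply/polyP => m.
rewrite -!polyC_natr !(coefD, coefN, coefCM, coefXM, coef_theta, coefXn, coef_poly).
case: m => [|m] /=; first by rewrite !(mulr0, mulr0n, subr0).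
rewrite !ltnS eqSS; case: (ltngtP m N) => [ltmN|ltNm|->].
- rewrite /= mulr0 subr0 -!mulrnA -!natrM -!natrD -!natrM.
  by congr _%:R; have := trinom_rec m; lia.
- by rewrite !(mulr0, mul0rn, addr0, subr0).
- have -> : 3%:R * (9%:R * ((trinom N)%:R *+ N *+ N) + 9%:R * ((trinom N)%:R *+ N)
    + 2%:R * (trinom N)%:R) = ((N.+1 ^ 2 * trinom N.+1)%N%:R : rat).
    rewrite -!mulrnA -!natrM -!natrD -!natrM trinom_rec; congr _%:R; ring.
  by rewrite !mul0rn mulr1 subrr.
Qed.

Lemma clausen_poly_ode N : exists e : rat,
  th (th (th (clausen_poly N))) =
    6%:R * ('X * (18%:R * th (th (th (clausen_poly N))) + 27%:R * th (th (clausen_poly N))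
                  + 13%:R * th (clausen_poly N) + 2%:R * clausen_poly N))
    - e%:P * 'X^(N.+1).
Proof.
exists ((N.+1 ^ 3 * clausen_coef N.+1)%N%:R); apply/polyP => m.
rewrite -!polyC_natr !(coefD, coefN, coefCM, coefXM, coef_theta, coefXn, coef_poly).
case: m => [|m] /=; first by rewrite !(mulr0, mulr0n, subr0).
rewrite !ltnS eqSS; case: (ltngtP m N) => [ltmN|ltNm|->].
- rewrite /= mulr0 subr0 -!mulrnA -!natrM -!natrD -!natrM.
  congr _%:R. transitivity (m.+1 ^ 3 * clausen_coef m.+1)%N; first by ring.
  rewrite clausen_coef_rec; ring.
- by rewrite !(mulr0, mul0rn, addr0, subr0).
- have -> : 6%:R * (18%:R * ((clausen_coef N)%:R *+ N *+ N *+ N) + 27%:R * ((clausen_coef N)%:R *+ N *+ N)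
     + 13%:R * ((clausen_coef N)%:R *+ N) + 2%:R * (clausen_coef N)%:R) = ((N.+1 ^ 3 * clausen_coef N.+1)%N%:R : rat).
    rewrite -!mulrnA -!natrM -!natrD -!natrM clausen_coef_rec; congr _%:R; ring.
  by rewrite !mul0rn mulr1 subrr.
Qed.

Lemma theta_CXn (e : rat) n : th (e%:P * 'X^n) = n%:R * (e%:P * 'X^n).
Proof.
apply/polyP => m; rewrite coef_theta -polyC_natr !coefCM coefXn.
by case: eqP => [->|_]; rewrite ?mulr0 ?mul0rn // mulr1 mulr_natl.
Qed.

(** The hypothesis and its [theta]-derivative reduce d * theta^2 q and
    d * theta^3 q to combinations of q and theta q. Substituting both in
    [clausen_op (q ^+ 2)], expanded by the Leibniz rule, cancels everything
    except multiples of the defect monomial. *)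
Lemma clausen_op_sqr q e n :
  th (th q) = 3%:R * ('X * (9%:R * th (th q) + 9%:R * th q + 2%:R * q)) - e%:P * 'X^n ->
  exists g, clausen_op (q ^+ 2) = 'X^n * g.
Proof.
move=> ode.
(* Collecting the second derivatives turns the leading coefficient into d. *)
have ode2 : d * th (th q) = 27%:R * 'X * th q + 6%:R * 'X * q - e%:P * 'X^n.
  rewrite {1}/d mulrBl mul1r {1}ode; ring.
have ode3 : d * th (th (th q)) =
   54%:R * 'X * th (th q) + 33%:R * 'X * th q + 6%:R * 'X * q - n%:R * (e%:P * 'X^n).
  have := congr1 th ode2.
  rewrite thetaM theta_d !thetaD thetaN theta_CXn !(thetaM _ q) !(thetaM _ (th q)) !theta_natX.
  move: (th (th (th q))) => q3 H.
  transitivity (- (27%:R * 'X) * th (th q) + d * q3 + 27%:R * 'X * th (th q)); first by ring.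
  rewrite H; ring.
exists (e%:P * (-6%:R * d * th q + 54%:R * 'X * q - 2%:R * n%:R * d * q)).
rewrite /clausen_op expr2 !(thetaM, thetaD).
transitivity (6%:R * d * th q * (d * th (th q)) + 2%:R * q * d * (d * th (th (th q)))
  - 81%:R * 'X * (2%:R * d * th q ^+ 2 + 2%:R * q * (d * th (th q)))
  - (51%:R * 'X - 2106%:R * 'X ^+ 2) * (2%:R * q * th q) - (12%:R * 'X - 648%:R * 'X ^+ 2) * q ^+ 2); first by ring.
rewrite ode3 ode2.
transitivity (6%:R * d * th q * (27%:R * 'X * th q + 6%:R * 'X * q - e%:P * 'X^n) +
2%:R * q * 
(54%:R * 'X * (d * th (th q)) + d * (33%:R * 'X * th q + 6%:R * 'X * q - n%:R * (e%:P * 'X^n))) -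
81%:R * 'X * (2%:R * d * th q ^+ 2 + 2%:R * q * (27%:R * 'X * th q + 6%:R * 'X * q - e%:P * 'X^n)) -
(51%:R * 'X - 2106%:R * 'X^2) * (2%:R * q * th q) - (12%:R * 'X - 648%:R * 'X^2) * q ^+ 2); first by ring.
rewrite ode2 /d; ring.
Qed.

(** Chain rule for the substitution x (1 - 27x): its logarithmic derivative
    is h / d. *)
Lemma theta_comp q : d * th (q \Po clausen_arg) = h * (th q \Po clausen_arg).
Proof.
have -> : th q \Po clausen_arg = clausen_arg * (q^`() \Po clausen_arg) by rewrite theta.unlock comp_polyM comp_polyX.
rewrite theta.unlock deriv_comp.
have -> : clausen_arg^`() = h.
  by rewrite /clausen_arg /d /h derivM derivB derivM -polyC_natr !derivC derivX; ring.
rewrite /clausen_arg; ring.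
Qed.

Lemma d_neq0 : d != 0.
Proof.
apply/eqP => /(congr1 (fun q : {poly rat} => q`_0)).
by rewrite /d coefB coefMX coef1 coef0.
Qed.

(** By the chain rule, d * [clausen_op (q \Po clausen_arg)] is h times the
    third-order hypergeometric operator of q evaluated at [clausen_arg], thanks
    to h ^+ 2 = 1 - 108 * clausen_arg. The defect of the hypothesis becomes a
    power of 'X * d, from which the factor d cancels. *)
Lemma clausen_op_comp q e n :
  th (th (th q)) = 6%:R * ('X * (18%:R * th (th (th q)) + 27%:R * th (th q)
                  + 13%:R * th q + 2%:R * q)) - e%:P * 'X^(n.+1) ->
  exists g, clausen_op (q \Po clausen_arg) = 'X^(n.+1) * g.
Proof.
move=> ode; exists (- h * e%:P * d ^+ n).
apply: (mulfI d_neq0).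
pose S := q \Po clausen_arg; pose C1 := th q \Po clausen_arg.
pose C2 := th (th q) \Po clausen_arg; pose C3 := th (th (th q)) \Po clausen_arg.
have odeC : C3 = 6%:R * (clausen_arg * (18%:R * C3 + 27%:R * C2 + 13%:R * C1 + 2%:R * S))
   - e%:P * clausen_arg ^+ n.+1.
  by rewrite {1}/C3 ode -!polyC_natr !rmorphB /= !(comp_polyD, comp_polyM, comp_polyC, comp_polyX, comp_Xn_poly).
have S1 : d * th S = h * C1 := theta_comp q.
have D1 : d * th C1 = h * C2 := theta_comp _.
have D2 : d * th C2 = h * C3 := theta_comp _.
have S2 : d ^+ 2 * th (th S) = h ^+ 2 * C2 - 27%:R * 'X * C1.
  have := congr1 th S1; rewrite !thetaM theta_d theta_h => H.
  transitivity (d * (- (27%:R * 'X) * th S + d * th (th S)) + 27%:R * 'X * (d * th S)); first by ring.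
  rewrite H S1.
  transitivity (d * (- (54%:R * 'X) * C1) + h * (d * th C1) + 27%:R * 'X * (h * C1)); first by ring.
  rewrite D1 /d /h; ring.
have S3 : d ^+ 3 * th (th (th S)) = 54%:R * 'X * (h ^+ 2 * C2 - 27%:R * 'X * C1)
   + h ^+ 3 * C3 - 108%:R * 'X * h * d * C2 - 27%:R * 'X * h * C2 - 27%:R * 'X * d * C1.
  have := congr1 th S2; rewrite !expr2 thetaD.
  have -> : th (- (27%:R * 'X * C1)) = - (27%:R * 'X * C1) - 27%:R * 'X * th C1.
    by rewrite thetaN thetaM theta_natX; ring.
  rewrite !thetaM theta_d theta_h => H.
  transitivity (d * ((- (27%:R * 'X) * d + d * - (27%:R * 'X)) * th (th S) + d * d * th (th (th S)))
     + 54%:R * 'X * (d ^+ 2 * th (th S))); first by ring.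
  rewrite H S2.
  transitivity (d * ((- (54%:R * 'X) * h + h * - (54%:R * 'X)) * C2 - 27%:R * 'X * C1)
     + h * h * (d * th C2) - 27%:R * 'X * (d * th C1)
     + 54%:R * 'X * (h ^+ 2 * C2 - 27%:R * 'X * C1)); first by ring.
  rewrite D2 D1; ring.
rewrite /clausen_op -/S.
transitivity (d ^+ 3 * th (th (th S)) - 81%:R * 'X * (d ^+ 2 * th (th S))
  - (51%:R * 'X - 2106%:R * 'X ^+ 2) * (d * th S) - (12%:R * 'X - 648%:R * 'X ^+ 2) * (d * S)); first by ring.
rewrite S3 S2 S1.
transitivity (h * (C3 - 6%:R * (clausen_arg * (18%:R * C3 + 27%:R * C2 + 13%:R * C1 + 2%:R * S)))).
  rewrite /clausen_arg /d /h; ring.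
rewrite {1}odeC /clausen_arg exprMn !exprS; ring.
Qed.

(** The coefficient of 'X^m in [clausen_op q] is m^3 q_m plus a combination of
    the two preceding coefficients, so the equation determines q from its
    constant term. *)
Lemma clausen_op_coef0 q n : q`_0 = 0 -> (exists g, clausen_op q = 'X^n * g) ->
  forall m, (m < n)%N -> q`_m = 0.
Proof.
move=> q0 [g Lq]; elim/ltn_ind => m IH ltmn.
case: m IH ltmn => // m IH ltmn.
have := congr1 (fun r : {poly rat} => r`_m.+1) Lq.
rewrite coefXnM ltmn.
have -> : clausen_op q = th (th (th q)) - 'X * (54%:R * th (th (th q)) + 81%:R * th (th q)
   + 51%:R * th q + 12%:R * q) + 'X * ('X * (729%:R * th (th (th q)) + 2187%:R * th (th q) +
    2106%:R * th q + 648%:R * q)).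
  by rewrite /clausen_op /d; ring.
rewrite -!polyC_natr !(coefD, coefN, coefXM, coefCM, coef_theta) /=.
rewrite (IH m) //; last by lia.
case: m IH ltmn => [|m] IH ltmn /=.
  by rewrite !(mul0rn, mulr0, addr0, subr0, mulr1n).
rewrite (IH m) //; last by lia.
rewrite !mul0rn.
move: 54%:R 81%:R 51%:R 12%:R 729%:R 2187%:R 2106%:R 648%:R => c1 c2 c3 c4 c5 c6 c7 c8.
rewrite !mulr0 ?addr0 ?oppr0 ?addr0.
by move/eqP; rewrite !mulrn_eq0 /= => /eqP.
Qed.

(** Clausen's formula 2F1(1/3, 2/3; 1; 27x)^2 = 3F2(1/2, 1/3, 2/3; 1, 1;
    108 x (1 - 27x)): both sides satisfy the same third-order equation up to
    order N and have the same constant term. *)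
Lemma clausen_trunc N m : (m <= N)%N -> (trinom_poly N ^+ 2)`_m = (clausen_poly N \Po clausen_arg)`_m.
Proof.
move=> lemN; apply/eqP; rewrite -subr_eq0 -coefB; apply/eqP.
have [e1 /clausen_op_sqr [g1 L1]] := trinom_poly_ode N.
have [e2 /clausen_op_comp [g2 L2]] := clausen_poly_ode N.
apply: (@clausen_op_coef0 _ N.+1); last by [].
  rewrite coefB -!horner_coef0 horner_exp horner_comp /clausen_arg hornerM hornerX mul0r.
  by rewrite !horner_coef0 !coef_poly.
exists (g1 - g2); rewrite mulrBr -L1 -L2.
rewrite /clausen_op !(thetaD, thetaN); ring.
Qed.
End Clausen.

(** * A sum over a cubic form in three variables *)

Section PowerSums.
Variables (p : nat) (hp : prime p).

Lemma Fp_expp (x : 'F_p) : x ^+ p = x.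
Proof. by have := expf_card x; rewrite card_Fp. Qed.

Lemma Fp_expp1 (x : 'F_p) : x != 0 -> x ^+ p.-1 = 1.
Proof.
move=> x0; apply: (mulfI x0); rewrite -exprS prednK ?Fp_expp ?mulr1 //.
exact: prime_gt0.
Qed.

(** For 0 < i < p - 1 some nonzero g has g ^+ i != 1, since 'X^i - 1 has at most
    i roots; multiplication by g permutes the field and scales the sum by
    g ^+ i, so the sum vanishes. *)
Lemma power_sum (i : nat) : (i < p)%N ->
  \sum_(x : 'F_p) x ^+ i = if i == p.-1 then -1 else 0.
Proof.
move=> lt_ip; have p1 := prime_gt1 hp.
have pF0 : (p%:R : 'F_p) = 0 by apply: pchar_Fp_0.
case: (posnP i) => [->|i_gt0].
  rewrite (eq_bigr (fun=> 1)) ?sumr_const ?card_Fp // ?pF0.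
  by rewrite (_ : (0 == p.-1)%N = false) //; lia.
case: eqP => [->|ne_i].
  rewrite (bigD1 0) //= expr0n (_ : (p.-1 == 0)%N = false); last by lia.
  rewrite add0r (eq_bigr (fun=> 1)) => [|x x0].
    have := sumr_const [pred x : 'F_p | x != 0] (1 : 'F_p).
    rewrite cardC1 card_Fp // => ->.
    by apply/eqP; rewrite -addr_eq0 addrC -mulrS prednK ?pF0 //; lia.
  exact: Fp_expp1.
have [g g0 gi] : exists2 g : 'F_p, g != 0 & g ^+ i != 1.
  apply/exists_inP; apply: contraT; rewrite negb_exists_in => /forall_inP H.
  have := @max_poly_roots _ ('X^i - 1%:P : {poly 'F_p}) (enum [pred x : 'F_p | x != 0]).
  rewrite -size_poly_gt0 size_XnsubC // enum_uniq -cardE cardC1 card_Fp //.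
  rewrite (_ : all _ _); last first.
    apply/allP => x; rewrite mem_enum /= => /H /negPn /eqP x1.
    by rewrite rootE !hornerE x1 subrr.
  by move/(_ isT isT isT); lia.
have inj : injective (fun x : 'F_p => g * x) by apply: mulfI.
have E : \sum_(x : 'F_p) x ^+ i = g ^+ i * \sum_(x : 'F_p) x ^+ i.
  rewrite {1}(reindex_inj inj) mulr_sumr.
  by apply: eq_bigr => x _; rewrite exprMn.
have : (1 - g ^+ i) * \sum_(x : 'F_p) x ^+ i = 0 by rewrite mulrBl mul1r -E subrr.
by move/eqP; rewrite mulf_eq0 subr_eq0 eq_sym (negPf gi) => /eqP.
Qed.

Lemma sum_Fp_const (c : 'F_p) : \sum_(x : 'F_p) c = 0.
Proof. 
by rewrite sumr_const card_Fp // -mulr_natr pchar_Fp_0 // mulr0.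
Qed.

(** As p = 2 mod 3, cubing is inverted by raising to a power: 3 is coprime to
    p - 1. *)
Lemma cube_inj : p = 5 %[mod 6] -> injective (fun x : 'F_p => x ^+ 3).
Proof.
move=> p6.
(* (x^3)^(2n+1) = x^(2(p-1)+1)  with p = 3n+2 *)
(* With p = 3n + 2, the exponent 3 (2n + 1) is p + (p - 1). *)
pose n := (p %/ 3)%N.
have key (x : 'F_p) : (x ^+ 3) ^+ (2 * n).+1 = x.
  have xp := Fp_expp x.
  rewrite -exprM (_ : (3 * (2 * n).+1 = p + p.-1)%N); last by rewrite /n; lia.
  rewrite exprD xp -exprS prednK ?xp // prime_gt0 //.
by move=> x y /= E; rewrite -[x]key -[y]key E.
Qed.

(** Three times the cubic form x^3 + y^3 + z^3 + 6xyz is the sum of the cubes of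
    the three forms x + w^i y + w^(2i) z with w a primitive cube root of unity.
    The forms for i = 1, 2 depend only on the differences x - z and y - z, so in
    the coordinates u = x + y + z, x - z and y - z the form becomes u^3 + G with
    G free of u. Since cubing permutes the prime field, the sum over u does not
    depend on G, and summing this constant over the other two variables
    gives 0. *)
Lemma hesse_sum0 : p = 5 %[mod 6] ->
  \sum_(z : 'F_p) \sum_(x : 'F_p) \sum_(y : 'F_p)
    (6%:R * (x * y * z) + (x ^+ 3 + (y ^+ 3 + z ^+ 3))) ^+ p.-1 = 0.
Proof.
move=> p6; have p3 : (3%:R : 'F_p) != 0.
  rewrite -(dvdn_pcharf (pchar_Fp hp)) dvdn_prime2 //; apply/eqP; lia.
pose G (v w : 'F_p) := 2%:R * v ^+ 3 - 3%:R * v ^+ 2 * w - 3%:R * v * w ^+ 2 + 2%:R * w ^+ 3.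
have e3 : (3%:R : 'F_p) ^+ p.-1 = 1 := Fp_expp1 p3.
(* The factor 3 is harmless because 3 ^+ p.-1 = 1. *)
transitivity (\sum_(z : 'F_p) \sum_(v : 'F_p) \sum_(w : 'F_p)
   ((v + w + 3%:R * z) ^+ 3 + G v w) ^+ p.-1).
  apply: eq_bigr => z _; rewrite (reindex_inj (addIr z)).
  apply: eq_bigr => v _; rewrite (reindex_inj (addIr z)).
  apply: eq_bigr => w _ /=.
  transitivity ((3%:R * (6%:R * ((v + z) * (w + z) * z)
    + ((v + z) ^+ 3 + ((w + z) ^+ 3 + z ^+ 3)))) ^+ p.-1).
    by rewrite exprMn e3 mul1r.
  by congr (_ ^+ _); rewrite /G; ring.
rewrite exchange_big /=; under eq_bigr do rewrite exchange_big /=.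
rewrite (eq_bigr (fun=> 0)) ?big1_eq // => v _.
rewrite -[RHS](sum_Fp_const (-1)); apply: eq_bigr => w _.
rewrite -[RHS](_ : \sum_(u : 'F_p) u ^+ p.-1 = -1); last first.
  by rewrite power_sum ?eqxx // prednK // prime_gt0.
rewrite [RHS](reindex_inj (addIr (G v w))) /=.
rewrite [RHS](reindex_inj (cube_inj p6)) /=.
rewrite [RHS](reindex_inj (addrI (v + w))) /=.
by rewrite [RHS](reindex_inj (mulfI p3)).
Qed.
End PowerSums.

(** * The Hasse invariant of the cubic *)

(** A common bound N makes the ranges of nested binomial expansions independent
    of each other, so that these sums can be exchanged. *)
Lemma exprDn_wide (R : comNzRingType) (x y : R) n N : (n < N)%N ->
  (x + y) ^+ n = \sum_(i < N) (x ^+ (n - i) * y ^+ i) *+ 'C(n, i).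
Proof.
move=> ltnN; rewrite exprDn.
rewrite (big_ord_widen N (fun i => (x ^+ (n - i) * y ^+ i) *+ 'C(n, i)) ltnN).
rewrite big_mkcond; apply: eq_bigr => i _.
by rewrite ltnS; case: leqP => // /bin_small ->.
Qed.

Lemma coprime_fact p k : prime p -> (k < p)%N -> coprime p k`!.
Proof.
move=> hp; elim: k => [|k IH] ltkp; first by rewrite coprimen1.
rewrite factS coprimeMr IH ?(ltnW ltkp) // andbT prime_coprime //.
by apply/negP => /dvdn_leq; lia.
Qed.

Lemma dvdn_central_bin p k : prime p -> (k < p <= 2 * k)%N -> (p %| 'C(2 * k, k))%N.
Proof.
move=> hp /andP[ltkp lep].
have := coprimeXr 2 (coprime_fact hp ltkp) => /Gauss_dvdl <-.
by rewrite central_bin_fact dvdn_fact // prime_gt0.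
Qed.

Lemma dvdn_trinom p k : prime p -> (k < p <= 3 * k)%N -> (p %| trinom k)%N.
Proof.
move=> hp /andP[ltkp lep].
have := coprimeXr 3 (coprime_fact hp ltkp) => /Gauss_dvdl <-.
by rewrite trinom_fact dvdn_fact // prime_gt0.
Qed.

(** The factorial (3k)! is a multiple of (2p)!, which contains the two factors
    p and 2p, whereas k! is prime to p. *)
Lemma dvdn2_trinom p k : prime p -> (k < p)%N -> (2 * p <= 3 * k)%N -> (p ^ 2 %| trinom k)%N.
Proof.
move=> hp ltkp lep.
have := coprimeXl 2 (coprimeXr 3 (coprime_fact hp ltkp)) => /Gauss_dvdl <-.
rewrite trinom_fact -(bin_fact lep) mulnA dvdn_mulr // dvdn_mull //.
rewrite -(@bin_fact (2 * p) p); last by lia.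
rewrite (_ : (2 * p - p)%N = p); last by lia.
apply: dvdn_mull; rewrite expnS expn1.
by apply: dvdn_mul; rewrite dvdn_fact // leqnn prime_gt0.
Qed.

Section HesseExpansion.
Variables (p : nat) (hp : prime p).

(** Pascal's rule for 'C(p, j.+1), which vanishes modulo p. *)
Lemma bin_predp j : (j < p)%N -> ('C(p.-1, j)%:R : 'F_p) = (-1) ^+ j.
Proof.
elim: j => [|j IH] ltjp; first by rewrite bin0.
have p0 := prime_gt0 hp.
have := prime_dvd_bin hp (_ : (0 < j.+1 < p)%N) => /(_ ltjp).
rewrite -{2}(prednK p0) binS (dvdn_pcharf (pchar_Fp hp)) natrD IH ?(ltnW ltjp) //.
by rewrite addr_eq0 exprS mulN1r => /eqP.
Qed.

Definition hesse_term (l : nat) : 'F_p :=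
  6%:R ^+ (p.-1 - 3 * l) *+ ('C(p.-1, 3 * l) * trinom l).

(** In the trinomial expansion every monomial has degree 3 (p - 1). Its power sum
    vanishes as soon as one exponent is below p - 1, so only the monomial
    (xyz)^(p-1) survives, with value (-1)^3. It arises when l copies of each cube
    are chosen: this coefficient is the Hasse invariant of the cubic. *)
Lemma hesse_expand :
  \sum_(z : 'F_p) \sum_(x : 'F_p) \sum_(y : 'F_p)
    (6%:R * (x * y * z) + (x ^+ 3 + (y ^+ 3 + z ^+ 3))) ^+ p.-1
  = - \sum_(l < p) hesse_term l.
Proof.
have p1 := prime_gt1 hp.
pose c (i j l : nat) : 'F_p := 6%:R ^+ (p.-1 - i) *+ ('C(p.-1, i) * 'C(i, j) * 'C(j, l)).
(* Exponents of x, y and z when i factors are cubes, j of them in y or z, and l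
   of them in z. *)
pose e1 i j (l : nat) := (p.-1 - i + 3 * (i - j))%N.
pose e2 i j l := (p.-1 - i + 3 * (j - l))%N.
pose e3 i (j l : nat) := (p.-1 - i + 3 * l)%N.
have pointwise (x y z : 'F_p) :
    (6%:R * (x * y * z) + (x ^+ 3 + (y ^+ 3 + z ^+ 3))) ^+ p.-1
    = \sum_(t : 'I_p * 'I_p * 'I_p) c t.1.1 t.1.2 t.2 *
       (x ^+ e1 t.1.1 t.1.2 t.2 * (y ^+ e2 t.1.1 t.1.2 t.2 * z ^+ e3 t.1.1 t.1.2 t.2)).
  rewrite -(pair_bigA _ (fun (t : 'I_p * 'I_p) (l : 'I_p) => c t.1 t.2 l *
       (x ^+ e1 t.1 t.2 l * (y ^+ e2 t.1 t.2 l * z ^+ e3 t.1 t.2 l)))) /=.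
  rewrite -(pair_bigA _ (fun (i j : 'I_p) => \sum_(l < p) c i j l *
       (x ^+ e1 i j l * (y ^+ e2 i j l * z ^+ e3 i j l)))) /=.
  rewrite (@exprDn_wide _ _ _ _ p); last by lia.
  apply: eq_bigr => i _.
  rewrite (@exprDn_wide _ _ _ _ p) // mulr_sumr -sumrMnl.
  apply: eq_bigr => j _.
  rewrite (@exprDn_wide _ _ _ _ p) // mulr_sumr -sumrMnl mulr_sumr -sumrMnl.
  apply: eq_bigr => l _.
  rewrite /c /e1 /e2 /e3 (exprD x) (exprD y) (exprD z) !exprM !exprMn.
  ring.
pose S n := \sum_(x : 'F_p) x ^+ n.
transitivity (\sum_(i < p) \sum_(j < p) \sum_(l < p)
   c i j l * (S (e1 i j l) * (S (e2 i j l) * S (e3 i j l)))).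
  rewrite (pair_bigA _ (fun i j : 'I_p => \sum_(l < p)
     c i j l * (S (e1 i j l) * (S (e2 i j l) * S (e3 i j l))))) /=.
  rewrite (pair_bigA _ (fun (t : 'I_p * 'I_p) (l : 'I_p) =>
     c t.1 t.2 l * (S (e1 t.1 t.2 l) * (S (e2 t.1 t.2 l) * S (e3 t.1 t.2 l))))) /=.
  under eq_bigr => z _.
    under eq_bigr => x _ do (under eq_bigr do rewrite pointwise; rewrite exchange_big /=).
    rewrite exchange_big /=; over.
  rewrite exchange_big /=; apply: eq_bigr => [[[i j] l]] _ /=.
  rewrite /S 2!mulr_sumr mulr_sumr; apply: eq_bigr => z _.
  rewrite mulr_suml mulr_sumr; apply: eq_bigr => x _.
  by rewrite mulr_suml !mulr_sumr; apply: eq_bigr => y _.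
have term_eq (i j l : 'I_p) :
    c i j l * (S (e1 i j l) * (S (e2 i j l) * S (e3 i j l)))
    = if (j == 2 * l :> nat)%N && (i == 3 * l :> nat)%N then - hesse_term l else 0.
  have S_lt n : (n < p.-1)%N -> S n = 0.
    by move=> ltn; rewrite /S power_sum // ?ifN //; lia.
  have S_eq : S p.-1 = -1 by rewrite /S power_sum ?eqxx //; lia.
  have c0 : ~~ ((l <= j) && (j <= i))%N -> c i j l = 0.
    rewrite negb_and -!ltnNge /c => /orP[] /bin_small ->; rewrite ?muln0 ?mul0n ?muln0 mulr0n //.
  have [/andP[/eqP jE /eqP iE]|not_diag] := ifPn.
    have lt3l : (3 * l < p)%N by rewrite -iE.
    rewrite (_ : e1 _ _ _ = p.-1); last by rewrite /e1; lia.
    rewrite (_ : e2 _ _ _ = p.-1); last by rewrite /e2; lia.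
    rewrite (_ : e3 _ _ _ = p.-1); last by rewrite /e3; lia.
    rewrite S_eq !mulN1r opprK mulrN1 /c /hesse_term jE iE; congr (- (_ *+ _)).
    rewrite /trinom -mulnA; congr (_ * _)%N; rewrite mulnC; congr (_ * _)%N.
    by rewrite -[in LHS](bin_sub (_ : 2 * l <= 3 * l)%N) //; [congr 'C(_, _)|]; lia.
  have [/c0 ->|] := boolP (~~ ((l <= j) && (j <= i))%N); first by rewrite mul0r.
  rewrite negbK => /andP[lelj leji].
  (* The exponents sum to 3 (p - 1), so off the diagonal one is too small. *)
  case: (ltnP (e1 i j l) p.-1) => [/S_lt ->|ge1]; first by rewrite mul0r mulr0.
  case: (ltnP (e2 i j l) p.-1) => [/S_lt ->|ge2]; first by rewrite mul0r !mulr0.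
  case: (ltnP (e3 i j l) p.-1) => [/S_lt ->|ge3]; first by rewrite !mulr0.
  case/negP: not_diag; move: (ltn_ord i) ge1 ge2 ge3; rewrite /e1 /e2 /e3; lia.
rewrite (eq_bigr (fun i : 'I_p => \sum_(l < p) \sum_(j < p)
   if (j == 2 * l :> nat)%N && (i == 3 * l :> nat)%N then - hesse_term l else 0)).
  rewrite exchange_big -sumrN /=; apply: eq_bigr => l _.
  case: (ltnP (3 * l) p) => lt3l; last first.
    rewrite /hesse_term bin_small ?mul0n ?mulr0n ?oppr0; last by lia.
    rewrite big1 // => i _; rewrite big1 // => j _.
    by rewrite ifF //; have := ltn_ord i; lia.
  have lt2l : (2 * l < p)%N by lia.
  rewrite (bigD1 (Ordinal lt3l)) //= (bigD1 (Ordinal lt2l)) //= !eqxx /=.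
  rewrite [X in _ + X + _]big1 => [|j]; last first.
    by rewrite -val_eqE /= => /negPf ->.
  rewrite big1 ?addr0 // => i; rewrite -val_eqE /= => /negPf i3.
  by rewrite big1 // => j _; rewrite i3 andbF.
move=> i _; rewrite exchange_big /=; apply: eq_bigr => l _; apply: eq_bigr => j _.
exact: term_eq.
Qed.

(** For 3l < p this uses 'C(p.-1, 3 * l) = (-1) ^ l and 6 ^+ p.-1 = 1 in the
    prime field; for larger l both sides vanish. *)
Lemma hesse_termE l : (l < p)%N -> (6%:R : 'F_p) != 0 ->
  hesse_term l = (trinom l)%:R * (- (216%:R)^-1) ^+ l.
Proof.
move=> ltlp n6; rewrite /hesse_term.
have [lt3l|ge3l] := ltnP (3 * l) p; last first.
  rewrite bin_small ?mul0n ?mulr0n; last by lia.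
  have /eqP-> : ((trinom l)%:R : 'F_p) == 0.
    by rewrite -(dvdn_pcharf (pchar_Fp hp)) dvdn_trinom // ltlp.
  by rewrite mul0r.
rewrite -mulr_natl natrM bin_predp // mulrAC mulrC; congr (_ * _).
have -> : (216%:R : 'F_p) = 6%:R ^+ 3 by rewrite -natrX.
rewrite exprM (_ : (-1) ^+ 3 = -1 :> 'F_p); last by ring.
rewrite -[in RHS]mulN1r exprMn; congr (_ * _).
rewrite exprVn -exprM; apply: (mulIf (expf_neq0 (3 * l) n6)).
rewrite mulVf ?expf_neq0 // -exprD subnK; last by lia.
exact: Fp_expp1.
Qed.

Lemma coprime_p6 : p = 5 %[mod 6] -> coprime p 6.
Proof.
move=> p6; rewrite prime_coprime //; apply/negP => dvd6.
have le6 := dvdn_leq (isT : (0 < 6)%N) dvd6.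
have p5 : p = 5 by lia.
by move: dvd6; rewrite p5.
Qed.

Lemma trinom_sum0 : p = 5 %[mod 6] ->
  \sum_(l < p) (trinom l)%:R * (- (216%:R)^-1) ^+ l = 0 :> 'F_p.
Proof.
move=> p6; have n6 : (6%:R : 'F_p) != 0.
  by rewrite -(dvdn_pcharf (pchar_Fp hp)) -prime_coprime // coprime_p6.
have := hesse_sum0 hp p6; rewrite hesse_expand => /eqP; rewrite oppr_eq0.
by move/eqP => E; rewrite -[RHS]E; apply: eq_bigr => l _; rewrite hesse_termE.
Qed.
End HesseExpansion.

(** * Congruences between rational numbers *)

Section PIntegral.
Variable p : nat.

(** Any denominator prime to p will do, reduced or not; this is what makes the
    closure properties immediate. *)
Lemma p_integralP (u : rat) :
  reflect (exists n : nat, [/\ coprime p n, n != 0%N & n%:R * u \is a Num.int]) (p_integral p u).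
Proof.
apply: (iffP idP) => [cop|[n [cop n0 /intrP [z Ez]]]].
  exists `|denq u|%N; split=> //; first by rewrite absz_eq0 denq_neq0.
  by rewrite pmulrn absz_denq mulrC -numqE intr_int.
have n0' : (n%:R : rat) != 0 by rewrite pnatr_eq0.
rewrite /p_integral (_ : u = fracq (z, n%:Z)).
  rewrite den_fracq /=; case: ifP => _; last by rewrite coprimen1.
  by apply: coprime_dvdr cop; apply: dvdn_div; exact: dvdn_gcdr.
rewrite fracqE /= -Ez -pmulrn [RHS]mulrAC mulfV // mul1r //.
Qed.

Lemma p_integral_int (z : rat) : z \is a Num.int -> p_integral p z.
Proof. by move=> zZ; apply/p_integralP; exists 1%N; rewrite coprimen1 mul1r. Qed.

Lemma p_integral_natV n : coprime p n -> p_integral p (n%:R)^-1.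
Proof.
case: n => [|n] cop; first by rewrite invr0 p_integral_int ?int_num0.
by apply/p_integralP; exists n.+1; rewrite mulfV ?pnatr_eq0 // int_num1.
Qed.

Lemma p_integralM u v : p_integral p u -> p_integral p v -> p_integral p (u * v).
Proof.
move=> /p_integralP[m [cm m0 mu]] /p_integralP[n [cn n0 nv]]; apply/p_integralP.
exists (m * n)%N; rewrite coprimeMr cm cn muln_eq0 negb_or m0 n0; split=> //.
by rewrite natrM mulrACA rpredM.
Qed.

Lemma p_integralD u v : p_integral p u -> p_integral p v -> p_integral p (u + v).
Proof.
move=> /p_integralP[m [cm m0 mu]] /p_integralP[n [cn n0 nv]]; apply/p_integralP.
exists (m * n)%N; rewrite coprimeMr cm cn muln_eq0 negb_or m0 n0; split=> //.
rewrite natrM mulrDr {1}mulrAC -[X in _ + X]mulrA.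
by rewrite rpredD // rpredM // natr_int.
Qed.

Lemma p_integralN u : p_integral p u -> p_integral p (- u).
Proof. by move=> pu; rewrite -mulN1r p_integralM // p_integral_int // rpredN int_num1. Qed.

Lemma p_integralX u n : p_integral p u -> p_integral p (u ^+ n).
Proof.
move=> pu; elim: n => [|n IH]; first by rewrite expr0 p_integral_int ?int_num1.
by rewrite exprS p_integralM.
Qed.

Lemma p_integral_sum (I : Type) (r : seq I) (P : pred I) (F : I -> rat) :
  (forall i, P i -> p_integral p (F i)) -> p_integral p (\sum_(i <- r | P i) F i).
Proof.
move=> H; apply: (big_ind (p_integral p)) => //; last exact: p_integralD.
by rewrite p_integral_int ?int_num0.
Qed.

Lemma p_integral_horner (q : {poly rat}) x :
  (forall m, p_integral p q`_m) -> p_integral p x -> p_integral p q.[x].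
Proof.
move=> pq px; rewrite horner_coef; apply: p_integral_sum => i _.
by rewrite p_integralM // p_integralX.
Qed.

Lemma p_integral_dvd n d : (d %| n)%N -> p_integral p (n%:R / d%:R).
Proof.
move=> dvd; rewrite p_integral_int // -(divnK dvd) natrM.
have [->|d0] := eqVneq d 0%N; first by rewrite invr0 mulr0 int_num0.
by rewrite mulfK ?pnatr_eq0 // natr_int.
Qed.
End PIntegral.

(** * Reduction modulo the square of p *)

Section Assembly.
Variables (p : nat) (hp : prime p) (p6 : p = 5 %[mod 6]).
Let x : rat := - (216%:R)^-1.
Let T := trinom_poly p.-1.
Let S := clausen_poly p.-1 \Po clausen_arg.

Lemma coprime_p216 : coprime p 216.
Proof. by rewrite (_ : 216 = 6 ^ 3)%N // coprimeXr // (coprime_p6 hp). Qed.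

Lemma p_integral_x : p_integral p x.
Proof.
exact/p_integralN/(p_integral_natV coprime_p216).
Qed.

Lemma dvdz_Fp (z : int) : ((z%:~R : 'F_p) == 0) = (p %| `|z|)%N.
Proof.
rewrite (dvdn_pcharf (pchar_Fp hp)); case: z => n //=.
by rewrite NegzE mulrNz oppr_eq0.
Qed.

(** After multiplication by 216 ^+ p.-1 the value becomes an integer whose
    residue modulo p is known from the prime field. *)
Lemma trinom_poly_horner : p_integral p (T.[x] / p%:R).
Proof.
have p0 := prime_gt0 hp.
pose z : int := \sum_(l < p) (trinom l)%:R * ((-1) ^+ l * 216%:R ^+ (p.-1 - l)).
(* Stated over any field, to be used both in 'F_p and in the rationals. *)
have Fz (F : fieldType) : (216%:R : F) != 0 ->
    z%:~R = 216%:R ^+ p.-1 * \sum_(l < p) (trinom l)%:R * (- (216%:R)^-1) ^+ l :> F.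
  move=> n216; rewrite /z rmorph_sum mulr_sumr; apply: eq_bigr => l _ /=.
  rewrite !rmorphM !rmorphXn /= rmorphN1 !rmorph_nat [RHS]mulrCA; congr (_ * _).
  rewrite -[in RHS]mulN1r exprMn [RHS]mulrCA; congr (_ * _).
  have lel : (l <= p.-1)%N by have := ltn_ord l; lia.
  by rewrite -{2}(subnK lel) exprD -mulrA exprVn mulfV ?mulr1 // expf_neq0.
have /dvdnP[k Ek] : (p %| `|z|)%N.
  rewrite -dvdz_Fp Fz ?trinom_sum0 ?mulr0 //.
  rewrite -(dvdn_pcharf (pchar_Fp hp)) -prime_coprime //.
  exact: coprime_p216.
have n216 : (216%:R : rat) != 0 by rewrite pnatr_eq0.
have -> : T.[x] = z%:~R / 216%:R ^+ p.-1.
  rewrite (Fz _ n216) [RHS]mulrAC mulfV ?mul1r; last exact: expf_neq0.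
  by rewrite /T /trinom_poly (prednK p0) horner_poly.
rewrite mulrAC; apply: p_integralM; last first.
  rewrite -exprVn; exact/p_integralX/(p_integral_natV coprime_p216).
apply: p_integral_int; rewrite -[p%:R]/(p%:Z%:~R); apply: Qint_dvdz.
by rewrite dvdzE Ek dvdn_mull.
Qed.

Lemma coef_int_clausen_arg k m : (clausen_arg ^+ k)`_m \is a Num.int.
Proof.
apply/polyOverP/rpredX; rewrite /clausen_arg /one_sub_27X -polyC_natr.
by rewrite rpredM ?polyOverX // rpredB ?rpred1 // rpredM ?polyOverX // polyOverC natr_int.
Qed.

Lemma coef_clausen_arg_large k m : (2 * k < m)%N -> (clausen_arg ^+ k)`_m = 0.
Proof.
move=> lt2k; apply: nth_default; apply: leq_trans (size_poly_exp_leq _ _) _.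
have size_d : (size one_sub_27X <= 2)%N.
  rewrite /one_sub_27X -polyC_natr mul_polyC; apply: leq_trans (size_polyD _ _) _.
  rewrite size_polyN size_poly1 geq_max /=.
  by apply: leq_trans (size_scale_leq _ _) _; rewrite size_polyX.
have: (size clausen_arg <= 3)%N.
  by apply: leq_trans (size_polyMleq _ _) _; rewrite size_polyX; lia.
nia.
Qed.

(** Below degree p the truncations do not interfere with Clausen's formula. From
    degree p on, each side is divisible by p^2 on its own: in a product of two
    trinomial coefficients with indices summing to at least p, either both are
    divisible by p or one by p^2; and a power k of the quadratic [clausen_arg]
    reaches degree m >= p only if 2k >= p, where 'C(2k, k) is divisible
    by p. *)
Lemma clausen_mod_p2 m : p_integral p ((T ^+ 2 - S)`_m / (p ^ 2)%N%:R).
Proof.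
have p0 := prime_gt0 hp.
rewrite coefB; have [ltmp|lepm] := ltnP m p.
  by rewrite clausen_trunc ?subrr ?mul0r ?p_integral_int ?int_num0 //; lia.
rewrite mulrBl p_integralD ?p_integralN //.
  rewrite expr2 coefM mulr_suml p_integral_sum // => j _.
  rewrite !coef_poly prednK //.
  case: ltnP => ltjp; last by rewrite !mul0r p_integral_int ?int_num0.
  case: ltnP => ltmjp; last by rewrite mulr0 mul0r p_integral_int ?int_num0.
  have lejm := ltn_ord j.
  rewrite -natrM p_integral_dvd //.
  have [lt3j|] := ltnP (3 * j) p.
    by rewrite dvdn_mull // dvdn2_trinom //; lia.
  have [lt3mj|le3mj le3j] := ltnP (3 * (m - j)) p.
    by rewrite dvdn_mulr // dvdn2_trinom //; lia.
  by rewrite expnS expn1 dvdn_mul // dvdn_trinom ?ltjp ?ltmjp.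
rewrite /S /clausen_poly poly_def raddf_sum coef_sum mulr_suml p_integral_sum // => k _.
rewrite /= comp_polyZ comp_Xn_poly coefZ.
have [lt2k|le2k] := ltnP (2 * k) m.
  by rewrite coef_clausen_arg_large // mulr0 mul0r p_integral_int ?int_num0.
rewrite mulrAC; apply: p_integralM; last exact/p_integral_int/coef_int_clausen_arg.
rewrite p_integral_dvd // /clausen_coef dvdn_mulr // dvdn_exp2r // dvdn_central_bin //.
by have := ltn_ord k; lia.
Qed.
End Assembly.

Theorem theorem2p3 (p : nat) (hp : prime p) (hp6 : p = 5 %[mod 6]) :
  eqmod_p_integral p (p%:R ^+ 2)
    (\sum_(0 <= k < p)
       ('C(2 * k, k) ^ 2 * 'C(3 * k, k))%N%:R / (- 192%:R) ^+ k)
    0.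
Proof.
set s := \sum_(_ <= _ < _) _; pose x : rat := - (216%:R)^-1.
have p0 := prime_gt0 hp.
have pn0 : (p%:R : rat) != 0 by rewrite pnatr_eq0; lia.
have sE : s = (clausen_poly p.-1 \Po clausen_arg).[x].
  (* x = -1/216 solves x (1 - 27x) = -1/192. *)
  rewrite horner_comp (_ : clausen_arg.[x] = (- 192%:R)^-1); last first.
    rewrite /clausen_arg /one_sub_27X -polyC_natr hornerM hornerD hornerN hornerM !hornerC hornerX.
    by rewrite /x; field.
  rewrite /clausen_poly prednK // horner_poly /s big_mkord.
  by apply: eq_bigr => k _; rewrite [X in _ = _ * X]exprVn.
(* s = T^2 - (T^2 - s) with T divisible by p at the point x and T^2 - s
   divisible by p^2 coefficientwise. *)
have s2 : p_integral p (s / p%:R ^+ 2).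
  have -> : s / p%:R ^+ 2 = ((trinom_poly p.-1).[x] / p%:R) ^+ 2
      - ((p ^ 2)%N%:R^-1 *: (trinom_poly p.-1 ^+ 2 - (clausen_poly p.-1 \Po clausen_arg))).[x].
    rewrite hornerZ hornerD hornerN horner_exp -sE natrX; field.
    by rewrite pn0.
  rewrite p_integralD ?p_integralX ?trinom_poly_horner // p_integralN //.
  apply: p_integral_horner (p_integral_x hp hp6) => m.
  by rewrite coefZ mulrC clausen_mod_p2.
split.
- rewrite -[s](divfK (expf_neq0 2 pn0)) p_integralM //.
  by rewrite -natrX p_integral_int ?natr_int.
- by rewrite p_integral_int ?int_num0.
- by rewrite subr0.
Qed.
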